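(* The number of fixed-III-planes in $\mathrm{PG}(8,q)$ is $$\frac{q^3(q^2-1)(q-1)(q^2+q+1)}{q^2+q+1-\mathrm g(q-\mathrm n+1)}.$$ Each fixed-III-plane contains exactly $\mathrm g$ fixed points, $\mathrm g(q-\mathrm n)$ II$_{\vdots}$-points and $q^2+q+1-\mathrm g(q-\mathrm n+1)$ III$_{.:}$-points, and contains exactly $\mathrm g$ fixed-II-lines.
   Context: Let $q>2$ be a prime power, $\mathrm n\in\{-1,0,1\}$ with $q\equiv\mathrm n\pmod 3$, $\mathrm g=\gcd(3,q-1)$. Let $\phi$ be a collineation of $\mathrm{PG}(2,q^3)$ of order 3 fixing pointwise an $\mathbb F_q$-subplane $\mathcal P_{2,q}$. A point $\bar P$ of $\mathrm{PG}(2,q^3)$ has Type I if in $\mathcal P_{2,q}$, Type II if $\bar P,\bar P^\phi,\bar P^{\phi^2}$ are distinct and collinear, Type III if non-collinear. Bose representation: identifying $\mathbb F_{q^3}^3$ with $\mathbb F_q^9$, each point $\bar P$ corresponds to a plane $[\![P]\!]$ of $\mathrm{PG}(8,q)$; a point is an X-point if it lies in $[\![P]\!]$ with $\bar P$ of Type X. $\phi$ induces a projectivity $\sigma$ of $\mathrm{PG}(8,q)$ of order 3 with $[\![P]\!]^\sigma=[\![P^\phi]\!]$. A fixed point is a point fixed by $\sigma$. A II-point $B$ is a II$_{\vdots}$-point if $B,B^\sigma,B^{\sigma^2}$ are collinear; every III-point is called a III$_{.:}$-point. A fixed-II-line is a $\sigma$-fixed line containing a II$_{\vdots}$-point. A fixed-III-plane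 is a $\sigma$-fixed plane containing at least one III-point.
   Formalization: The projectivity σ is additionally required to be induced by a linear map fixing the three vectors of a frame of the subplane; order 3 and [[P]]^σ=[[P^φ]] alone also allow x↦c·x^q with the norm of c a non-cube (q≡1 mod 3), which has no fixed points. *)

(* Defs.v *)
From HB Require Import structures.
From mathcomp Require Import all_boot all_order all_algebra.
Set Implicit Arguments.
Unset Strict Implicit.
Unset Printing Implicit Defensive.
Import GRing.Theory VectorInternalTheory.
Local Open Scope ring_scope.

HB.instance Definition _ (F : finFieldType) (V : vectType F) :=
  [Countable of {vspace V} by <:].
HB.instance Definition _ (F : finFieldType) (V : vectType F) :=
  [Finite of {vspace V} by <:].

(* [k] is the projective dimension, so the vector dimension is [k.+1]. *)
Record flat (F : finFieldType) (V : vectType F) (k : nat) := Flat {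
  flat_space :> {vspace V};
  _ : \dim flat_space == k.+1 }.

HB.instance Definition _ (F : finFieldType) (V : vectType F) (k : nat) :=
  [isSub for @flat_space F V k].
HB.instance Definition _ (F : finFieldType) (V : vectType F) (k : nat) :=
  [Countable of flat V k by <:].
HB.instance Definition _ (F : finFieldType) (V : vectType F) (k : nat) :=
  [Finite of flat V k by <:].

Notation point V := (flat V 0).
Notation line V := (flat V 1).
Notation plane V := (flat V 2).

Definition collinear (F : finFieldType) (V : vectType F)
    (P Q R : {vspace V}) : bool :=
  [exists l : line V, [&& P <= l, Q <= l & R <= l]%VS].

Definition collineation (F : finFieldType) (V : vectType F)
    (phi : point V -> point V) : Prop :=
  bijective phi /\
  forall P Q R, collinear (phi P) (phi Q) (phi R) = collinear P Q R.

Definition has_order3 (T : Type) (phi : T -> T) : Prop :=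
  (forall x, phi (phi (phi x)) = x) /\ (exists x, phi x <> x).

(* The points with coordinates in the subfield [f K], relative to the basis of
   L^3 formed by the rows of [E]; every subplane over [f K] has this form for
   some invertible [E]. *)
Definition subplane (K L : finFieldType) (f : {rmorphism K -> L})
    (E : 'M[L]_3) : {set point 'rV[L]_3} :=
  [set P | [exists a : 'rV[K]_3,
     (a != 0) && (flat_space P == <[map_mx f a *m E]>%VS)]].

Definition type_II (L : finFieldType)
    (phi : point 'rV[L]_3 -> point 'rV[L]_3) (P : point 'rV[L]_3) : bool :=
  uniq [:: P; phi P; phi (phi P)] && collinear P (phi P) (phi (phi P)).

Definition type_III (L : finFieldType)
    (phi : point 'rV[L]_3 -> point 'rV[L]_3) (P : point 'rV[L]_3) : bool :=
  ~~ collinear P (phi P) (phi (phi P)).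

(* L^3 is a K-space through [f]. *)
Definition identification (K L : finFieldType) (f : {rmorphism K -> L})
    (iota : 'rV[L]_3 -> 'rV[K]_9) : Prop :=
  bijective iota /\
  forall (a : K) (u v : 'rV[L]_3),
    iota (f a *: u + v) = a *: iota u + iota v.

(* When [iota] is an identification the image of P is already a K-subspace, of
   dimension [L : K]; the span only packages it as a {vspace}. *)
Definition bose (K L : finFieldType) (iota : 'rV[L]_3 -> 'rV[K]_9)
    (P : point 'rV[L]_3) : {vspace 'rV[K]_9} :=
  <<[seq iota v | v in flat_space P]>>%VS.

(* The first two conditions, [lker sigma == 0] and compatibility with [phi],
   determine the projectivity only up to composition with the maps induced by
   the scalars of L.  The last one selects the linear map which, in the
   coordinates given by [E], is the coordinatewise action of a field
   automorphism of L.  Without it the projectivity could be without fixed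
   points: x |-> c x^q, with the norm of c not a cube in K. *)
Definition induced_by (K L : finFieldType) (iota : 'rV[L]_3 -> 'rV[K]_9)
    (E : 'M[L]_3) (phi : point 'rV[L]_3 -> point 'rV[L]_3)
    (sigma : 'End('rV[K]_9)) : Prop :=
  [/\ lker sigma = 0%VS,
      forall P, (sigma @: bose iota P)%VS = bose iota (phi P)
    & forall i : 'I_3, sigma (iota (row i E)) = iota (row i E)].

Definition fixed (K : finFieldType) (sigma : 'End('rV[K]_9))
    (U : {vspace 'rV[K]_9}) : bool :=
  (sigma @: U)%VS == U.

Definition II_point (K L : finFieldType) (iota : 'rV[L]_3 -> 'rV[K]_9)
    (phi : point 'rV[L]_3 -> point 'rV[L]_3) (B : point 'rV[K]_9) : bool :=
  [exists P, type_II phi P && (B <= bose iota P)%VS].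

Definition III_point (K L : finFieldType) (iota : 'rV[L]_3 -> 'rV[K]_9)
    (phi : point 'rV[L]_3 -> point 'rV[L]_3) (B : point 'rV[K]_9) : bool :=
  [exists P, type_III phi P && (B <= bose iota P)%VS].

Definition II_collinear_point (K L : finFieldType)
    (iota : 'rV[L]_3 -> 'rV[K]_9) (phi : point 'rV[L]_3 -> point 'rV[L]_3)
    (sigma : 'End('rV[K]_9)) (B : point 'rV[K]_9) : bool :=
  II_point iota phi B && collinear B (sigma @: B) (sigma @: (sigma @: B)).

Definition fixed_II_line (K L : finFieldType)
    (iota : 'rV[L]_3 -> 'rV[K]_9) (phi : point 'rV[L]_3 -> point 'rV[L]_3)
    (sigma : 'End('rV[K]_9)) (l : line 'rV[K]_9) : bool :=
  fixed sigma l &&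
  [exists B, II_collinear_point iota phi sigma B && (B <= l)%VS].

Definition fixed_III_plane (K L : finFieldType)
    (iota : 'rV[L]_3 -> 'rV[K]_9) (phi : point 'rV[L]_3 -> point 'rV[L]_3)
    (sigma : 'End('rV[K]_9)) (pi : plane 'rV[K]_9) : bool :=
  fixed sigma pi && [exists B, III_point iota phi B && (B <= pi)%VS].

(* Main.v *)
Require Import Defs.
From HB Require Import structures.
From mathcomp Require Import all_boot all_order all_algebra.
From mathcomp Require Import all_fingroup all_solvable all_field.
From mathcomp Require Import zify ring.
Set Implicit Arguments.
Unset Strict Implicit.
Unset Printing Implicit Defensive.
Import GRing.Theory.
Local Open Scope ring_scope.

(** Transported to L^3 by [iota], the map [sigma] is additive, fixes the rows of
    [E] and permutes the L-lines; hence in the coordinates given by [E] it is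
    the coordinatewise action of an automorphism [tau] of L, fixing K, with
    [tau^3 = 1] and [tau <> 1].

    A vector [v] is of Type III iff [v, v^sigma, v^sigma^2] are independent over
    L, and then the only fixed plane through it is their K-span [W], in which
    independence over K and over L agree.  On [W] the operator [sigma] has a
    cyclic vector, so its fixed points and fixed lines are the kernels and the
    images of the [sigma - k], for [k] a cube root of unity in K.  The orbit of
    [w = a v + b v^sigma + c v^sigma^2] has the circulant matrix of [(a, b, c)]
    as coordinate matrix, so the III-points of [W] correspond to invertible
    circulants.  The determinant of a circulant is [(a + b + c)^3] in
    characteristic 3; in general it is [a + b + c] times a quadratic form in
    [(a - b, b - c)] which is anisotropic unless K has primitive cube roots of
    unity.

    For the number of planes, [(1, b, b^2)] is of Type III as soon as
    [tau b <> b]; its products with the invertible 3x3 matrices over K are all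
    the vectors of Type III, and each III-point lies on one fixed-III-plane. *)

Lemma card_incidence (T1 T2 : finType) (P : pred T1) (Q : pred T2)
    (inc : T1 -> T2 -> bool) a b :
  (forall x, P x -> #|[set y | Q y & inc x y]| = a) ->
  (forall y, Q y -> #|[set x | P x & inc x y]| = b) ->
  (#|[set x | P x]| * a = #|[set y | Q y]| * b)%N.
Proof.
move=> card_a card_b; rewrite -!sum_nat_const.
transitivity (\sum_(x in [set x | P x]) \sum_(y | Q y && inc x y) 1)%N.
  by apply: eq_bigr => x; rewrite inE => /card_a <-; rewrite sum1dep_card.
rewrite (exchange_big_dep (mem [set y | Q y])) /= => [|x y _ /andP[]]; last first.
  by rewrite inE.
apply: eq_bigr => y; rewrite inE => Qy; rewrite -(card_b y Qy) sum1dep_card.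
by apply: eq_card => x; rewrite !inE Qy.
Qed.

(** * Roots of unity and circulants over a finite field *)

Section FiniteField.
Variable K : finFieldType.
Local Notation q := #|K|.

Lemma finField_pred_gt0 : (0 < q.-1)%N.
Proof. by rewrite -subn1 subn_gt0 finNzRing_gt1. Qed.

Lemma expf_card_pred (x : K) : x != 0 -> x ^+ q.-1 = 1.
Proof.
move=> x0; apply: (mulfI x0).
by rewrite -exprS mulr1 prednK ?expf_card // ltnW ?finNzRing_gt1.
Qed.

Lemma finField_prim_root : exists z : K, (q.-1).-primitive_root z.
Proof.
have /hasP[z _ z_prim] : has (q.-1).-primitive_root (enum (predC1 (0 : K))).
  apply: has_prim_root; rewrite ?finField_pred_gt0 ?enum_uniq -?cardE ?cardC1 //.
  apply/allP => x; rewrite mem_enum inE unity_rootE => x0; apply/eqP.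
  exact: expf_card_pred.
by exists z.
Qed.

Lemma card_unity_roots n : (0 < n)%N ->
  #|[set x : K | x ^+ n == 1]| = gcdn n q.-1.
Proof.
move=> n_gt0; set d := gcdn n q.-1; have [z z_prim] := finField_prim_root.
have {z z_prim} [z z_prim] : exists z : K, d.-primitive_root z.
  by exists (z ^+ (q.-1 %/ d)); apply: dvdn_prim_root; rewrite ?dvdn_gcdr.
rewrite -[RHS]card_ord -(card_imset (f := fun i : 'I_d => z ^+ i) 'I_d); last first.
  move=> i j /eqP; rewrite (eq_prim_root_expr z_prim) !modn_small //.
  by move/eqP/val_inj.
apply: eq_card => x; rewrite inE; apply/eqP/imsetP => [xn|[i _ ->]].
  suff /(prim_rootP z_prim)[i ->] : x ^+ d = 1 by exists i.
  have [m x_prim m_dvd] := prim_order_exists n_gt0 xn.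
  apply/eqP; rewrite -(prim_order_dvd x_prim) dvdn_gcd m_dvd /=.
  rewrite (prim_order_dvd x_prim) expf_card_pred //; apply: contra_eq_neq xn => ->.
  by rewrite expr0n gtn_eqF // eq_sym oner_eq0.
have /dvdnP[c ->] := dvdn_gcdl n q.-1.
by rewrite exprAC mulnC exprM (prim_expr_order z_prim) !expr1n.
Qed.

Lemma pchar_finFieldE p : prime p -> (p \in [pchar K]) = (p %| q)%N.
Proof.
move=> p_prime; have [r r_prime rK] := finPcharP K.
have r_group := pprimeChar_pgroup rK; rewrite (pcharf_eq rK) -cardsT.
apply/idP/idP => [/eqP->|p_dvd]; last exact: (pgroupP r_group).
by have [] := pgroup_pdiv r_group (finNzRing_nontrivial K).
Qed.

End FiniteField.

Definition circulant (R : Type) (n : nat) (x : 'rV[R]_n.+1) : 'M[R]_n.+1 :=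
  \matrix_(i, j) x 0 (j - i).

Lemma det_circulant3 (R : comNzRingType) (x : 'rV[R]_3)
    (a := x 0 0) (b := x 0 1) (c := x 0 2%:R) :
  \det (circulant x) = a ^+ 3 + b ^+ 3 + c ^+ 3 - 3%:R * a * b * c.
Proof.
have circulantE i j : circulant x i j = [:: a; b; c]`_((j + (3 - i)) %% 3).
  by rewrite mxE; case: i j => [[|[|[|//]]] ?] [[|[|[|//]]] ?] /=;
    congr (x _ _); apply: val_inj.
move: (circulant x) circulantE => C CE.
rewrite (expand_det_row _ ord0) !big_ord_recr big_ord0 /= add0r /cofactor.
rewrite !(expand_det_row _ ord0) !big_ord_recr !big_ord0 /= !add0r /cofactor.
by rewrite !det_mx11 !mxE !CE /= ?expr0 ?expr1; ring.
Qed.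

Lemma row3_eq (R : Type) (x y : 'rV[R]_3) :
  x 0 0 = y 0 0 -> x 0 1 = y 0 1 -> x 0 2%:R = y 0 2%:R -> x = y.
Proof.
move=> e0 e1 e2; apply/rowP => -[[|[|[|//]]] ?]; [move: e0|move: e1|move: e2];
  by congr (x _ _ = y _ _); apply: val_inj.
Qed.

Lemma gcdn3_pred_mod3 (q : nat) (n : int) : (1 < q)%N ->
  n \in [:: -1; 0; 1] -> (q%:Z = n %[mod 3])%Z ->
  gcdn 3 q.-1 = (if n == 1 then 3 else 1)%N /\ (3 %| q)%N = (n == 0).
Proof.
move=> q_gt1 n_val n_mod; split; last first.
  by move: n_val n_mod; rewrite !inE => /or3P[] /eqP-> /=; lia.
have [/eqP n1|n1] := ifPn.
  by apply/gcdn_idPl; move: n_mod; rewrite n1; lia.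
apply/eqP; rewrite -/(coprime _ _) prime_coprime //.
by move: n_val n_mod n1; rewrite !inE => /or3P[] /eqP-> /=; lia.
Qed.

Section CirculantCount.
Variable K : finFieldType.
Local Notation q := #|K|.
Local Notation g := (gcdn 3 q.-1).

Lemma card_unit_circulant3_pchar3 : 3%N \in [pchar K] ->
  #|[set x : 'rV[K]_3 | circulant x \in unitmx]| = (q ^ 2 * q.-1)%N.
Proof.
move=> K3.
pose coordinates_sum (x : 'rV[K]_3) := (x 0 0, x 0 1, x 0 0 + x 0 1 + x 0 2%:R).
have coordinates_sum_inj : injective coordinates_sum.
  by move=> x y [e0 e1]; rewrite e0 e1 => /addrI; apply: row3_eq.
rewrite (_ : [set _ | _] = coordinates_sum @^-1: setX [set: K * K] [set~ 0]).
  rewrite on_card_preimset; last first.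
    apply: onW_bij; apply: inj_card_bij => //.
    by rewrite card_mx !card_prod !expnS expn0 muln1 mulnA.
  by rewrite cardsX cardsC1 cardsT card_prod mulnn.
apply/setP => x; rewrite !inE /= unitmxE unitfE det_circulant3.
have K3nat : [pchar K].-nat 3 by rewrite pnatE.
by rewrite (pcharf0 K3) !mul0r subr0 -!exprDn_pchar // expf_eq0.
Qed.

Section CharNot3.
Hypothesis K3 : 3%N \notin [pchar K].

Let natr3_neq0 : 3%:R != 0 :> K. Proof. by move: K3; rewrite inE. Qed.

Lemma primitive_cube_rootE (x : K) :
  (x ^+ 2 + x + 1 == 0) = (x ^+ 3 == 1) && (x != 1).
Proof.
have [->|x1] := eqVneq x 1.
  by rewrite andbF expr1n (_ : 1 + 1 + 1 = 3%:R) ?(negPf natr3_neq0) //; ring.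
rewrite andbT -[RHS]subr_eq0.
rewrite (_ : x ^+ 3 - 1 = (x - 1) * (x ^+ 2 + x + 1)); last by ring.
by rewrite mulf_eq0 subr_eq0 (negPf x1).
Qed.

Definition norm_form (p : K * K) : K := p.1 ^+ 2 + p.1 * p.2 + p.2 ^+ 2.

Lemma norm_form_zeros : [set p | norm_form p == 0] = (0, 0) |:
  [set (x.1 * x.2, x.2) | x in setX ([set x | x ^+ 3 == 1] :\ 1) [set~ 0]].
Proof.
apply/setP => -[d e]; rewrite in_set in_setU1 /norm_form /=; apply/eqP/predU1P.
  have [->|e0] := eqVneq e 0.
    by rewrite mulr0 expr0n !addr0 => /eqP; rewrite expf_eq0 => /eqP ->; left.
  move=> zero; right; apply/imsetP; exists (d / e, e); last by rewrite /= divfK.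
  rewrite !inE e0 andbT andbC -primitive_cube_rootE /=; apply/eqP.
  by apply: (mulIf (expf_neq0 2 e0)); rewrite mul0r -zero; field.
case=> [[-> ->]|]; first by ring.
case/imsetP=> -[x y]; rewrite !inE /= [(_ != 1) && _]andbC -primitive_cube_rootE.
case/andP=> /eqP x_root _ [-> ->].
by transitivity ((x ^+ 2 + x + 1) * y ^+ 2); [ring | rewrite x_root mul0r].
Qed.

Lemma card_norm_form_zeros : #|[set p | norm_form p == 0]| = (g.-1 * q.-1).+1.
Proof.
rewrite norm_form_zeros cardsU1 (_ : (0, 0) \notin _); last first.
  by apply/imsetP => -[[x y]]; rewrite !inE /= => /andP[_ /eqP y0] [_ /esym].
rewrite card_in_imset => [|[x d] [y e]]; last first.
  by rewrite !inE /= => /andP[_ d0] _ [+ de]; rewrite -de => /(mulIf d0) ->.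
rewrite cardsX cardsC1 -card_unity_roots // [in RHS](cardsD1 1) inE expr1n eqxx.
by rewrite !add1n.
Qed.

Lemma card_norm_form_neq0 :
  #|[set p | norm_form p != 0]| = (q.-1 * (q + 2 - g))%N.
Proof.
have g_gt0 : (0 < g)%N by rewrite gcdn_gt0.
have g_le : (g <= q.-1)%N by rewrite dvdn_leq ?dvdn_gcdr ?finField_pred_gt0.
have := cardsC [set p | norm_form p == 0]; rewrite card_prod card_norm_form_zeros.
rewrite (_ : ~: _ = [set p | norm_form p != 0]); last first.
  by apply/setP => p; rewrite !inE.
move: g_gt0 g_le; case: g => // m _; move/subnKC; move: (_ - _)%N => k q1E.
have qE : q = (m + k).+2 by rewrite -(prednK (ltnW (finNzRing_gt1 K))) -q1E.
by rewrite qE /=; nia.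
Qed.

Lemma card_unit_circulant3 :
  #|[set x : 'rV[K]_3 | circulant x \in unitmx]| = (q.-1 ^ 2 * (q + 2 - g))%N.
Proof.
pose sum_differences (x : 'rV[K]_3) :=
  (x 0 0 + x 0 1 + x 0 2%:R, (x 0 0 - x 0 1, x 0 1 - x 0 2%:R)).
have sum_differences_inj : injective sum_differences.
  move=> x y [sum_eq e01 e12].
  have e2 : x 0 2%:R = y 0 2%:R.
    apply: (mulfI natr3_neq0).
    have tripleE (a b c : K) :
        3%:R * c = (a + b + c) - (a - b) - 2%:R * (b - c) by ring.
    by rewrite (tripleE (x 0 0) (x 0 1)) (tripleE (y 0 0) (y 0 1)) sum_eq e01 e12.
  move: e12; rewrite e2 => /addIr e1; move: e01; rewrite e1 => /addIr e0.
  exact: row3_eq.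
rewrite (_ : [set _ | _] = sum_differences @^-1: setX [set~ 0]
    [set p | norm_form p != 0]).
  rewrite on_card_preimset; last first.
    apply: onW_bij; apply: inj_card_bij => //.
    by rewrite card_mx !card_prod !expnS expn0 muln1 mulnA.
  by rewrite cardsX cardsC1 card_norm_form_neq0 mulnA.
apply/setP => x; rewrite !inE /= unitmxE unitfE det_circulant3 -negb_or -mulf_eq0.
by congr (_ != 0); rewrite /norm_form /=; ring.
Qed.

End CharNot3.

Lemma card_unit_circulant3_mod3 (n : int) :
  n \in [:: -1; 0; 1] -> (q%:Z = n %[mod 3])%Z ->
  exists N : nat, [/\ (0 < N)%N,
    N%:Z = q%:Z ^+ 2 + q%:Z + 1 - g%:Z * (q%:Z - n + 1)
  & #|[set x : 'rV[K]_3 | circulant x \in unitmx]| = (N * q.-1)%N].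
Proof.
move=> n_val n_mod; have q_gt1 := finNzRing_gt1 K.
have [g_n K3_n] := gcdn3_pred_mod3 q_gt1 n_val n_mod.
have [K3|K3] := boolP (3%N \in [pchar K]).
  exists (q ^ 2)%N; split; first by rewrite expn_gt0 ltnW.
    move: K3; rewrite g_n pchar_finFieldE // K3_n => /eqP ->.
    by rewrite mul1r subr0 -[_ + _ + 1]addrA addrK.
  exact: card_unit_circulant3_pchar3.
have g_le : (g <= q.-1)%N by rewrite dvdn_leq ?dvdn_gcdr ?finField_pred_gt0.
exists (q.-1 * (q + 2 - g))%N; split.
- by rewrite muln_gt0 -subn1 !subn_gt0 q_gt1; move: g_le; lia.
- have n0 : n != 0 by rewrite -K3_n -pchar_finFieldE.
  move: n_val n0 g_le q_gt1; rewrite g_n; case: #|K| => // q; rewrite !inE PoszM.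
  case/or3P => /eqP -> //= _ g_le _.
    by rewrite (_ : (q.+1 + 2 - 1 = q.+2)%N); lia.
  by rewrite (_ : (q.+1 + 2 - 3 = q)%N); lia.
- by rewrite card_unit_circulant3 // mulnAC mulnn.
Qed.

End CirculantCount.

(** * Linear algebra *)

Section VectorSpaces.
Variables (F : fieldType) (V : vectType F).
Implicit Types (U W : {vspace V}) (u v w : V).

Lemma vline_eq u v : u != 0 -> u \in <[v]>%VS -> <[u]>%VS = <[v]>%VS.
Proof.
move=> u0 uv; apply/eqP; rewrite eqEdim -memvE uv !dim_vline u0.
exact: leq_b1.
Qed.

Lemma dim1_vline U : \dim U = 1%N -> exists2 u, u != 0 & U = <[u]>%VS.
Proof.
move=> dimU; have u0 : vpick U != 0 by rewrite vpick0 -dimv_eq0 dimU.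
exists (vpick U) => //; apply/esym/eqP.
by rewrite eqEdim -memvE memv_pick dimU dim_vline u0.
Qed.

Lemma dim_addv_vline U u : u \notin U -> \dim (U + <[u]>) = (\dim U).+1.
Proof.
move=> uU; have u0 : u != 0 by apply: contraNneq uU => ->; rewrite mem0v.
rewrite dimv_disjoint_sum ?dim_vline ?u0 ?addn1 //; apply/eqP; rewrite -subv0.
apply/subvP => x /memv_capP[xU /vlineP[a xa]].
by move: xU; rewrite xa rpredZeq (negPf uU) orbF => /eqP ->; rewrite scale0r mem0v.
Qed.

Lemma exists_subv_dim U k : (\dim U <= k <= \dim {:V})%N ->
  exists2 W, \dim W = k & (U <= W)%VS.
Proof.
case/andP=> Uk k_le; have UC_free : free (vbasis U ++ vbasis U^C%VS).
  rewrite cat_free !(basis_free (vbasisP _)) !(span_basis (vbasisP _)).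
  by apply/directv_addP; rewrite capv_compl.
exists <<take k (vbasis U ++ vbasis U^C%VS)>>%VS.
  rewrite -{1}(cat_take_drop k (_ ++ _)) in UC_free.
  rewrite (eqP (catl_free UC_free)) size_takel // size_cat !size_tuple dimv_compl.
  by rewrite subnKC ?dimvS ?subvf.
by rewrite take_cat size_tuple ltnNge Uk /= span_cat (span_basis (vbasisP U)) addvSl.
Qed.

Lemma limg_stableP (s : 'End(V)) U :
  reflect {homo s : u / u \in U} (s @: U <= U)%VS.
Proof.
apply: (iffP subvP) => [sU u uU|sU _ /memv_imgP[u uU ->]]; last exact: sU.
by apply: sU; apply: memv_img.
Qed.

Lemma limg_stable_eq (s : 'End(V)) U :
  lker s == 0%VS -> ((s @: U)%VS == U) = (s @: U <= U)%VS.
Proof.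
by move=> /eqP s_inj; rewrite eqEdim limg_dim_eq ?leqnn ?andbT // s_inj capv0.
Qed.

Lemma free_lincomb m n (X : n.-tuple V) (A : 'M[F]_(m, n)) : free X ->
  free [tuple \sum_j A i j *: X`_j | i < m] = row_free A.
Proof.
move=> /freeP X_free; have combE (k : 'I_m -> F) :
    \sum_(i < m) k i *: [tuple \sum_j A i' j *: X`_j | i' < m]`_i =
    \sum_j (\row_i k i *m A) 0 j *: X`_j.
  under eq_bigr do rewrite nth_mktuple scaler_sumr.
  rewrite exchange_big; apply: eq_bigr => j _; rewrite mxE scaler_suml.
  by apply: eq_bigr => i _; rewrite mxE scalerA.
apply/freeP/idP => [Y_free|A_free k].
  apply: inj_row_free => x xA; apply/rowP => i; rewrite mxE.
  apply: (Y_free (fun i => x 0 i)); rewrite combE (_ : \row__ _ = x).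
    by rewrite xA big1 // => j _; rewrite mxE scale0r.
  by apply/rowP => j; rewrite mxE.
rewrite combE => /X_free kA i.
have /eqP : \row_i k i *m A = 0 by apply/rowP => j; rewrite kA mxE.
by rewrite mulmx_free_eq0 // => /eqP/rowP/(_ i); rewrite !mxE.
Qed.

End VectorSpaces.

Section RestrictionOfScalars.
Variables (K L : fieldType) (f : {rmorphism K -> L}).
Variables (U : vectType L) (V : vectType K) (iota : U -> V).
Hypothesis iota_inj : injective iota.
Hypothesis iota_lin : forall a u v, iota (f a *: u + v) = a *: iota u + iota v.

Lemma restr_scalarsD : {morph iota : u v / u + v}.
Proof. by move=> u v; rewrite -[u]scale1r -(rmorph1 f) iota_lin rmorph1 !scale1r. Qed.

Lemma restr_scalars0 : iota 0 = 0.
Proof. by apply: (addrI (iota 0)); rewrite -restr_scalarsD !addr0. Qed.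

Lemma restr_scalarsZ a u : iota (f a *: u) = a *: iota u.
Proof. by rewrite -[f a *: u]addr0 iota_lin restr_scalars0 addr0. Qed.

Lemma restr_scalars_eq0 u : (iota u == 0) = (u == 0).
Proof. by rewrite -(inj_eq iota_inj) restr_scalars0. Qed.

Lemma restr_scalars_lincomb n (a : 'I_n -> K) (X : n.-tuple U) :
  iota (\sum_i f (a i) *: X`_i) = \sum_i a i *: (map_tuple iota X)`_i.
Proof.
rewrite (big_morph iota restr_scalarsD restr_scalars0); apply: eq_bigr => i _.
by rewrite restr_scalarsZ (nth_map 0) ?size_tuple.
Qed.

Lemma free_restr_scalars n (X : n.-tuple U) : free X -> free (map iota X).
Proof.
move/freeP=> X_free; apply/(@freeP _ _ _ (map_tuple iota X)) => a.
rewrite -restr_scalars_lincomb => /eqP; rewrite restr_scalars_eq0 => /eqP.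
by move/X_free => a0 i; apply/eqP; rewrite -(fmorph_eq0 f) a0.
Qed.

(* The coordinate matrix of [Y] on [X] has entries in [K], and [f] preserves rank. *)
Lemma free_restr_scalarsE m n (X : n.-tuple U) (Y : m.-tuple U) : free X ->
  {subset map iota Y <= <<map iota X>>%VS} -> free (map iota Y) = free Y.
Proof.
move=> X_free YX; have iX_free := free_restr_scalars X_free.
pose iX := map_tuple iota X.
pose A := \matrix_(i < m, j < n) coord iX j (iota Y`_i).
have iYE (i : 'I_m) : iota Y`_i = \sum_j A i j *: iX`_j.
  under eq_bigr do rewrite mxE.
  by apply/(coord_span (X := iX))/YX/map_f/mem_nth; rewrite size_tuple.
have YE : Y = [tuple \sum_j map_mx f A i j *: X`_j | i < m].
  apply: eq_from_tnth => i; rewrite tnth_mktuple (tnth_nth 0); apply: iota_inj.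
  by rewrite iYE -restr_scalars_lincomb; under [in RHS]eq_bigr do rewrite mxE.
have -> : map iota Y = [tuple \sum_j A i j *: iX`_j | i < m].
  apply: (congr1 (@tval _ _) (x := map_tuple iota Y)); apply: eq_from_tnth => i.
  by rewrite tnth_mktuple tnth_map (tnth_nth 0).
by rewrite free_lincomb // [in RHS]YE free_lincomb // /row_free mxrank_map.
Qed.

End RestrictionOfScalars.

(** * Points and flats of a projective space *)

Section Flats.
Variables (F : finFieldType) (V : vectType F).
Implicit Types (U : {vspace V}) (u v w : V) (B : point V).

Lemma flat_space_inj k : injective (@flat_space F V k).
Proof. exact: val_inj. Qed.

Lemma dim_flat k (A : flat V k) : \dim A = k.+1.
Proof. exact/eqP/(valP A). Qed.

Lemma exists_flat k U : \dim U = k.+1 -> exists A : flat V k, flat_space A = U.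
Proof. by move/eqP=> dimU; exists (Flat dimU). Qed.

Lemma vector_point v : v != 0 -> exists B, flat_space B = <[v]>%VS.
Proof. by move=> v0; apply: exists_flat; rewrite dim_vline v0. Qed.

Lemma point_vector B : exists2 v, v != 0 & flat_space B = <[v]>%VS.
Proof. exact/dim1_vline/dim_flat. Qed.

Lemma mem_pointE B v : v != 0 -> (v \in flat_space B) = (flat_space B == <[v]>%VS).
Proof.
move=> v0; apply/idP/eqP => [|->]; last exact: memv_line.
by have [w _ ->] := point_vector B; move/(vline_eq v0)->.
Qed.

Lemma card_flats k (P : pred {vspace V}) :
  #|[set A : flat V k | P A]| = #|[set U | (\dim U == k.+1) && P U]|.
Proof.
rewrite -(card_imset _ (@flat_space_inj k)); apply: eq_card => U; rewrite inE.
apply/imsetP/andP => [[A + ->]|[/eqP/exists_flat[A <-] PA]].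
  by rewrite inE dim_flat.
by exists A; rewrite ?inE.
Qed.

Lemma collinearE u v w : (1 < \dim {:V})%N ->
  collinear <[u]> <[v]> <[w]> = ~~ free [:: u; v; w].
Proof.
move=> V_gt1.
have span3 U : (<<[:: u; v; w]>> <= U)%VS =
    [&& <[u]> <= U, <[v]> <= U & <[w]> <= U]%VS.
  by rewrite !span_cons span_nil addv0 !subv_add.
apply/existsP/idP => [[l]|nfree].
  by rewrite -span3 => /dimvS; rewrite dim_flat; apply: contraL => /eqP ->.
have span_le2 : (\dim <<[:: u; v; w]>> <= 2)%N.
  by rewrite -ltnS ltn_neqAle nfree (dim_span [:: u; v; w]).
have [|W dimW spanW] := @exists_subv_dim _ _ <<[:: u; v; w]>>%VS 2.
  by rewrite span_le2.
by have [l lW] := exists_flat dimW; exists l; rewrite -span3 lW.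
Qed.

End Flats.

Section PointCount.
Variables (F : finFieldType) (n : nat).
Local Notation V := 'rV[F]_n.

Lemma card_vspace_neq0 (U : {vspace V}) :
  #|[set v | (v != 0) && (v \in U)]| = (#|F| ^ \dim U).-1.
Proof.
rewrite -card_vspace [in RHS](cardD1 0) mem0v add1n /=.
by apply: eq_card => v; rewrite !inE.
Qed.

Lemma card_points (Q : pred (point V)) (R : pred V) :
  (forall B v, v != 0 -> flat_space B = <[v]>%VS -> Q B = R v) ->
  (#|[set B | Q B]| * #|F|.-1)%N = #|[set v : V | (v != 0) && R v]|.
Proof.
move=> QR; rewrite -[RHS]muln1.
apply: (card_incidence (Q := fun v => (v != 0) && R v)
                       (inc := fun B v => v \in flat_space B)) => [B QB|v].
  transitivity (#|F| ^ \dim B).-1; last by rewrite dim_flat expn1.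
  rewrite -card_vspace_neq0; apply: eq_card => v.
  rewrite !inE -andbA; case: eqVneq => //= v0; rewrite andb_idl // mem_pointE //.
  by move/eqP => Bv; rewrite -(QR B).
case/andP=> v0 Rv; have [B Bv] := vector_point v0.
rewrite (_ : [set _ | _] = [set B]) ?cards1 //; apply/setP => C.
rewrite !inE mem_pointE // -Bv (inj_eq (@flat_space_inj _ _ _)) andbC.
by case: eqP => //= ->; rewrite (QR B v).
Qed.

Lemma card_points_sub (U : {vspace V}) :
  #|[set B : point V | (B <= U)%VS]| = (\sum_(i < \dim U) #|F| ^ i)%N.
Proof.
apply/eqP; rewrite -(eqn_pmul2r (finField_pred_gt0 F)).
rewrite (card_points (R := mem U)) => [|B v _ ->]; last by rewrite -memvE.
by rewrite card_vspace_neq0 predn_exp mulnC.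
Qed.

End PointCount.

(** * Operators with a cyclic vector *)

Definition orbit_space (F : fieldType) (V : vectType F) (s : V -> V) n v :
  {vspace V} := <<traject s v n>>%VS.

Definition cyclic_vector (F : fieldType) (V : vectType F) (s : V -> V) n v : bool :=
  free (traject s v n).

Lemma dim_orbit_space (F : fieldType) (V : vectType F) (s : V -> V) n v :
  cyclic_vector s n v -> \dim (orbit_space s n v) = n.
Proof. by move/eqP; rewrite size_traject. Qed.

Lemma cyclic_vector_neq0 (F : fieldType) (V : vectType F) (s : V -> V) n v :
  cyclic_vector s n.+1 v -> v != 0.
Proof. by move=> v_cyclic; rewrite (free_not0 v_cyclic) // inE eqxx. Qed.

Lemma orbit_space_min (F : fieldType) (V : vectType F) (s : 'End(V)) n v
    (U : {vspace V}) :
  (s @: U <= U)%VS -> v \in U -> (orbit_space s n v <= U)%VS.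
Proof.
move/limg_stableP=> sU vU; apply/span_subvP => _ /trajectP[i _ ->].
by elim: i => //= i; apply: sU.
Qed.

Lemma cyclic_vector_dim (F : fieldType) (V : vectType F) (s : 'End(V)) n v
    (U : {vspace V}) :
  (s @: U <= U)%VS -> v \in U -> cyclic_vector s n v -> (n <= \dim U)%N.
Proof.
by move=> sU vU /dim_orbit_space {1}<-; apply/dimvS/orbit_space_min.
Qed.

Lemma trajectE (T : Type) (s : T -> T) x n :
  traject s x n = [tuple iter i s x | i < n] :> seq T.
Proof.
apply: (@eq_from_nth _ x) => [|i]; rewrite size_traject ?size_tuple // => i_lt.
by rewrite nth_traject // (nth_mktuple _ x (Ordinal i_lt)).
Qed.

(* The orbits have [n.+1] elements, so that their indices form the group ['I_n.+1]. *)
Section CyclicOperator.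
Variables (F : fieldType) (V : vectType F) (s : 'End(V)) (n : nat).
Hypothesis s_order : forall u, iter n.+1 s u = u.
Implicit Types (u v w : V) (U : {vspace V}) (k : F).

Local Notation W v := (orbit_space s n.+1 v).

Definition eigenspace_on U k : {vspace V} := (U :&: lker (s - k *: \1%VF))%VS.
Definition eigenimage_on U k : {vspace V} := ((s - k *: \1%VF) @: U)%VS.

Lemma sub_scalarE k u : (s - k *: \1)%VF u = s u - k *: u.
Proof. by rewrite !(lfunE, id_lfunE) /= !(lfunE, id_lfunE) /= !lfunE /= id_lfunE. Qed.

Lemma mem_eigenspace_on U k u :
  (u \in eigenspace_on U k) = (u \in U) && (s u == k *: u).
Proof. by rewrite memv_cap memv_ker sub_scalarE subr_eq0. Qed.

Lemma mem_eigenimage_on U k u : u \in U -> s u - k *: u \in eigenimage_on U k.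
Proof. by move=> uU; rewrite -sub_scalarE memv_img. Qed.

Lemma lker_finite_order : lker s == 0%VS.
Proof.
apply/lker0P => u v suv; rewrite -(s_order u) -(s_order v) !iterSr.
by rewrite suv.
Qed.

Lemma eigenvalue_unity_root k u : u != 0 -> s u = k *: u -> k ^+ n.+1 = 1.
Proof.
move=> u0 su; have iter_su i : iter i s u = k ^+ i *: u.
  elim: i => [|i IH]; first by rewrite scale1r.
  by rewrite iterS IH linearZ /= su scalerA -exprSr.
apply/eqP; have := s_order u; rewrite iter_su => /eqP.
by rewrite -subr_eq0 -{2}[u]scale1r -scalerBl scaler_eq0 (negPf u0) orbF subr_eq0.
Qed.

Lemma orbit_space_mem v : v \in W v.
Proof. by apply: memv_span; rewrite /= inE eqxx. Qed.

Lemma orbit_space_stable v : (s @: W v <= W v)%VS.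
Proof.
rewrite limg_span; apply/span_subvP => _ /mapP[_ /trajectP[i i_lt ->] ->].
move: i_lt; rewrite -iterS ltnS leq_eqVlt => /predU1P[->|i_lt].
  by rewrite s_order orbit_space_mem.
by apply/memv_span/trajectP; exists i.+1.
Qed.

Lemma orbit_space_image v u : u \in W v -> s u \in W v.
Proof. exact: limg_stableP (orbit_space_stable v) _. Qed.

Lemma orbit_space_iter v i : iter i s v \in W v.
Proof.
by elim: i => [|i IH]; [apply: orbit_space_mem | apply: orbit_space_image].
Qed.

Section CyclicVector.
Variable v : V.
Hypothesis v_cyclic : cyclic_vector s n.+1 v.

Lemma orbit_space_sub_eigenimage k : (W v <= eigenimage_on (W v) k + <[v]>)%VS.
Proof.
have vW := orbit_space_mem v.
apply: orbit_space_min; last by rewrite memvE addvSr.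
apply/limg_stableP => _ /memv_addP[_ /memv_imgP[u uW ->] [_ /vlineP[a ->] ->]].
rewrite sub_scalarE [s (_ + _)]linearD /= [s (a *: v)]linearZ /=.
rewrite -[s v](subrK (k *: v)) scalerDr addrA; apply: memv_add.
  rewrite memvD ?memvZ ?mem_eigenimage_on //.
  by rewrite linearB linearZ mem_eigenimage_on ?orbit_space_image.
by rewrite !memvZ ?memv_line.
Qed.

Lemma dim_eigenimage_ge k : (n <= \dim (eigenimage_on (W v) k))%N.
Proof.
have := dimvS (orbit_space_sub_eigenimage k); rewrite dim_orbit_space // => W_le.
have [sum_le _] := dimv_add_leqif (eigenimage_on (W v) k) <[v]>.
have := leq_trans W_le sum_le; rewrite dim_vline.
by case: (v != 0); rewrite ?addn1 ?addn0 // => /ltnW.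
Qed.

Definition orbit_eigenvector k : V := \sum_(i < n.+1) k ^+ (n - i) *: iter i s v.

Lemma orbit_eigenvector_neq0 k : orbit_eigenvector k != 0.
Proof.
apply/eqP => sum0.
have /freeP : free [tuple iter i s v | i < n.+1] by rewrite -trajectE.
move=> /(_ (fun i => k ^+ (n - i))); under eq_bigr do rewrite nth_mktuple.
by move/(_ sum0 ord_max)/eqP; rewrite subnn oner_eq0.
Qed.

Lemma orbit_eigenvectorP k : k ^+ n.+1 = 1 ->
  s (orbit_eigenvector k) = k *: orbit_eigenvector k.
Proof.
move=> k_unity; apply/eqP; rewrite -subr_eq0 linear_sum scaler_sumr -sumrB; apply/eqP.
pose powers i := k ^+ (n.+1 - i) *: iter i s v.
rewrite (eq_bigr (fun i : 'I_n.+1 => powers i.+1 - powers i)) => [|i _].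
  rewrite -(big_mkord xpredT (fun i => powers i.+1 - powers i)) telescope_sumr //.
  by rewrite /powers subnn subn0 s_order k_unity subrr.
by rewrite /powers linearZ scalerA -exprS subSS subSn // -ltnS.
Qed.

Lemma dim_eigenspace k : k ^+ n.+1 = 1 -> \dim (eigenspace_on (W v) k) = 1%N.
Proof.
move=> k_unity; apply/eqP; rewrite eqn_leq; apply/andP; split.
  have := limg_ker_dim (s - k *: \1%VF) (W v); rewrite dim_orbit_space //.
  have := dim_eigenimage_ge k; rewrite /eigenimage_on /eigenspace_on; lia.
have e_eigen : orbit_eigenvector k \in eigenspace_on (W v) k.
  rewrite mem_eigenspace_on orbit_eigenvectorP // eqxx andbT.
  by apply: memv_suml => i _; rewrite memvZ ?orbit_space_iter.
rewrite lt0n dimv_eq0; apply: contraNneq (orbit_eigenvector_neq0 k) => eigen0.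
by rewrite -memv0 -eigen0.
Qed.

(* [s] acts on the quotient [W v / U], a line, as a scalar [k]. *)
Lemma eq_eigenimage U : \dim U = n -> (U <= W v)%VS -> (s @: U <= U)%VS ->
  exists2 k, k ^+ n.+1 = 1 & U = eigenimage_on (W v) k.
Proof.
move=> dimU UW sU; have vU : v \notin U.
  apply/negP => /(orbit_space_min n.+1 sU)/dimvS.
  by rewrite dim_orbit_space // dimU ltnn.
have UvW : (U + <[v]>)%VS = W v.
  apply/eqP; rewrite eqEdim subv_add UW -memvE orbit_space_mem /=.
  by rewrite dim_addv_vline // dimU dim_orbit_space.
have : s v \in (U + <[v]>)%VS.
  by rewrite UvW orbit_space_image ?orbit_space_mem.
case/memv_addP => x xU [_ /vlineP[k ->] svE].
have imE : U = eigenimage_on (W v) k.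
  apply/esym/eqP; rewrite eqEdim dimU dim_eigenimage_ge andbT.
  apply/subvP => _ /memv_imgP[u + ->]; rewrite -UvW.
  case/memv_addP => y yU [_ /vlineP[a ->] ->].
  rewrite [y + _]addrC linearP /= !sub_scalarE.
  by rewrite svE addrK memvD ?memvB ?memvZ // (limg_stableP _ _ sU).
exists k => //.
have := limg_ker_dim (s - k *: \1%VF) (W v).
rewrite -/(eigenimage_on _ _) -imE dimU dim_orbit_space // -/(eigenspace_on _ _).
move=> dimE; have : eigenspace_on (W v) k != 0%VS by rewrite -dimv_eq0; lia.
rewrite -vpick0 => u0; have := memv_pick (eigenspace_on (W v) k).
by rewrite mem_eigenspace_on => /andP[_ /eqP]; apply: eigenvalue_unity_root.
Qed.

Lemma eq_eigenspace U : \dim U = 1%N -> (U <= W v)%VS -> (s @: U <= U)%VS ->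
  exists2 k, k ^+ n.+1 = 1 & U = eigenspace_on (W v) k.
Proof.
move=> dimU UW /limg_stableP sU; have [u u0 UE] := dim1_vline dimU.
have uU : u \in U by rewrite UE memv_line.
have /vlineP[k suE] : s u \in <[u]>%VS by rewrite -UE sU.
have k_unity := eigenvalue_unity_root u0 suE; exists k => //.
apply/eqP; rewrite eqEdim dimU dim_eigenspace // andbT UE -memvE mem_eigenspace_on.
by rewrite suE eqxx (subvP UW).
Qed.

Lemma eigenspace_inj k l : k ^+ n.+1 = 1 ->
  eigenspace_on (W v) k = eigenspace_on (W v) l -> k = l.
Proof.
move=> k_unity eig_eq.
have [u u0 eigE] := dim1_vline (dim_eigenspace k_unity).
have uk : u \in eigenspace_on (W v) k by rewrite eigE memv_line.
have ul : u \in eigenspace_on (W v) l by rewrite -eig_eq.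
move: uk ul; rewrite !mem_eigenspace_on => /andP[_ /eqP ->] /andP[_].
by rewrite -subr_eq0 -scalerBl scaler_eq0 (negPf u0) orbF subr_eq0 => /eqP.
Qed.

Lemma eigenspace_stable k : (s @: eigenspace_on (W v) k <= eigenspace_on (W v) k)%VS.
Proof.
apply/limg_stableP => u; rewrite !mem_eigenspace_on => /andP[uW /eqP su].
by rewrite su memvZ //= linearZ /= su.
Qed.

Lemma dim_eigenimage k : k ^+ n.+1 = 1 -> \dim (eigenimage_on (W v) k) = n.
Proof.
move=> k_unity; have := limg_ker_dim (s - k *: \1%VF) (W v).
by rewrite dim_orbit_space // -/(eigenspace_on _ _) dim_eigenspace // => -[].
Qed.

Lemma eigenimage_stable k : (s @: eigenimage_on (W v) k <= eigenimage_on (W v) k)%VS.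
Proof.
apply/limg_stableP => _ /memv_imgP[u uW ->]; rewrite sub_scalarE linearB linearZ.
exact/mem_eigenimage_on/orbit_space_image.
Qed.

Lemma eigenimage_sub k : (eigenimage_on (W v) k <= W v)%VS.
Proof.
apply/subvP => _ /memv_imgP[u uW ->]; rewrite sub_scalarE.
by rewrite memvB ?memvZ // orbit_space_image.
Qed.

Lemma eigenimage_inj k l : k ^+ n.+1 = 1 ->
  eigenimage_on (W v) k = eigenimage_on (W v) l -> k = l.
Proof.
move=> k_unity im_eq; apply/eqP/negPn/negP => kl.
have : (W v <= eigenimage_on (W v) k)%VS.
  apply/subvP => u uW; have lk : l - k != 0 by rewrite subr_eq0 eq_sym.
  rewrite -[u](scalerK lk) memvZ //.
  rewrite (_ : (l - k) *: u = (s u - k *: u) - (s u - l *: u)).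
    by rewrite memvB ?mem_eigenimage_on // im_eq mem_eigenimage_on.
  by rewrite scalerBl opprB [RHS]addrC addrA subrK.
by move/dimvS; rewrite dim_orbit_space // dim_eigenimage // ltnn.
Qed.

End CyclicVector.
End CyclicOperator.

Section FixedFlatCount.
Variables (K : finFieldType) (V : vectType K) (s : 'End(V)) (n : nat) (v : V).
Hypothesis s_order : forall u, iter n.+1 s u = u.
Hypothesis v_cyclic : cyclic_vector s n.+1 v.
Local Notation W := (orbit_space s n.+1 v).

Lemma card_fixed_points :
  #|[set B : point V | (B <= W)%VS & (s @: B)%VS == B]| = gcdn n.+1 #|K|.-1.
Proof.
rewrite -card_unity_roots //.
rewrite (card_flats _ (fun B => (B <= W)%VS && ((s @: B)%VS == B))).
rewrite -(card_in_imset (f := eigenspace_on s W)); last first.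
  by move=> k l; rewrite !inE => /eqP k_unity _; apply: eigenspace_inj.
apply: eq_card => U; rewrite !inE limg_stable_eq ?(lker_finite_order s_order) //.
apply/and3P/imsetP => [[/eqP dimU UW sU]|[k + ->]].
  have [k k_unity ->] := eq_eigenspace s_order v_cyclic dimU UW sU.
  by exists k; rewrite // inE k_unity.
rewrite inE => /eqP k_unity.
by rewrite dim_eigenspace // capvSl eigenspace_stable.
Qed.

Lemma card_fixed_hyperplanes : (0 < n)%N ->
  #|[set H : flat V n.-1 | (H <= W)%VS & (s @: H)%VS == H]| = gcdn n.+1 #|K|.-1.
Proof.
move=> n_gt0; rewrite -card_unity_roots //.
rewrite (card_flats _ (fun H => (H <= W)%VS && ((s @: H)%VS == H))) prednK //.
rewrite -(card_in_imset (f := eigenimage_on s W)); last first.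
  by move=> k l; rewrite !inE => /eqP k_unity _; apply: eigenimage_inj.
apply: eq_card => U; rewrite !inE limg_stable_eq ?(lker_finite_order s_order) //.
apply/and3P/imsetP => [[/eqP dimU UW sU]|[k + ->]].
  have [k k_unity ->] := eq_eigenimage s_order v_cyclic dimU UW sU.
  by exists k; rewrite // inE k_unity.
rewrite inE => /eqP k_unity.
by rewrite dim_eigenimage // eigenimage_sub // eigenimage_stable.
Qed.

End FixedFlatCount.

Section OrbitCoordinates.
Variables (F : fieldType) (V : vectType F) (s : 'End(V)) (n : nat) (v : V).
Hypothesis s_order : forall u, iter n.+1 s u = u.
Hypothesis v_cyclic : cyclic_vector s n.+1 v.

Definition orbit_comb (x : 'rV[F]_n.+1) : V := \sum_j x 0 j *: iter j s v.

Let orbit : n.+1.-tuple V := [tuple iter i s v | i < n.+1].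

Let orbit_free : free orbit. Proof. by rewrite -trajectE. Qed.

Lemma orbit_combE x : orbit_comb x = \sum_j x 0 j *: orbit`_j.
Proof. by apply: eq_bigr => j _; rewrite nth_mktuple. Qed.

Lemma orbit_comb_inj : injective orbit_comb.
Proof.
move=> x y xy; apply/rowP => j.
rewrite -(coord_sum_free (x 0) j orbit_free) -orbit_combE xy orbit_combE.
exact: coord_sum_free.
Qed.

Lemma mem_orbit_spaceP u :
  reflect (exists x, u = orbit_comb x) (u \in orbit_space s n.+1 v).
Proof.
rewrite /orbit_space trajectE; apply: (iffP idP) => [/coord_span ->|[x ->]].
  exists (\row_j coord orbit j u); rewrite orbit_combE.
  by apply: eq_bigr => j _; rewrite mxE.
rewrite orbit_combE; apply: memv_suml => j _.
by rewrite memvZ // memv_span // mem_nth // size_tuple.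
Qed.

Lemma iter_order_mod i u : iter (i %% n.+1) s u = iter i s u.
Proof.
rewrite {2}(divn_eq i n.+1) addnC iterD; congr iter.
by elim: (i %/ _)%N => // m IH; rewrite mulSn iterD -IH s_order.
Qed.

Lemma iter_orbit_comb (i : 'I_n.+1) x :
  iter i s (orbit_comb x) = \sum_j circulant x i j *: orbit`_j.
Proof.
have shift m : iter m s (orbit_comb x) = \sum_j x 0 j *: iter (m + j) s v.
  elim: m => // m IH; rewrite iterS IH linear_sum; apply: eq_bigr => j _.
  by rewrite linearZ.
rewrite shift [RHS](reindex_inj (addrI i)); apply: eq_bigr => j _.
by rewrite mxE addrAC subrr add0r nth_mktuple /= iter_order_mod.
Qed.

Lemma cyclic_orbit_comb x :
  cyclic_vector s n.+1 (orbit_comb x) = (circulant x \in unitmx).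
Proof.
rewrite -row_free_unit -(free_lincomb _ orbit_free) /cyclic_vector trajectE.
congr free; congr tval; apply: eq_from_tnth => i.
by rewrite !tnth_mktuple iter_orbit_comb.
Qed.

End OrbitCoordinates.

Lemma card_cyclic_vectors (K : finFieldType) m n (s : 'End('rV[K]_m)) v :
  (forall u, iter n.+1 s u = u) -> cyclic_vector s n.+1 v ->
  #|[set u | (u \in orbit_space s n.+1 v) && cyclic_vector s n.+1 u]| =
  #|[set x : 'rV[K]_n.+1 | circulant x \in unitmx]|.
Proof.
move=> s_order v_cyclic.
rewrite -[RHS](card_imset _ (orbit_comb_inj v_cyclic)); apply: eq_card => u.
rewrite inE; apply/andP/imsetP => [[/mem_orbit_spaceP[x ->]]|[x + ->]].
  by rewrite cyclic_orbit_comb // => x_unit; exists x; rewrite ?inE.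
rewrite inE => x_unit; rewrite cyclic_orbit_comb //; split=> //.
by apply/mem_orbit_spaceP; exists x.
Qed.

Lemma free_rows (F : fieldType) m n (A : 'M[F]_(m, n)) :
  free [tuple row i A | i < m] = row_free A.
Proof.
pose delta := [tuple (delta_mx 0 j : 'rV[F]_n) | j < n].
have lincomb_delta (x : 'rV[F]_n) : \sum_j x 0 j *: delta`_j = x.
  by rewrite [RHS]row_sum_delta; apply: eq_bigr => j _; rewrite nth_mktuple.
have delta_free : free delta.
  apply/freeP => k k0 j; have := lincomb_delta (\row_i k i).
  under eq_bigr do rewrite mxE.
  by rewrite k0 => /rowP/(_ j); rewrite !mxE.
rewrite -(free_lincomb A delta_free); congr free; congr tval.
apply: eq_from_tnth => i; rewrite !tnth_mktuple -[LHS]lincomb_delta.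
by apply: eq_bigr => j _; rewrite mxE.
Qed.

(** * Semilinear maps and Moore matrices *)

Section Semilinear.
Variables (L : fieldType) (n : nat) (S : 'rV[L]_n.+2 -> 'rV[L]_n.+2).
Hypothesis S_additive : {morph S : x y / x + y}.
Hypothesis S_delta : forall i, S (delta_mx 0 i) = delta_mx 0 i.
Hypothesis S_line : forall a x, S (a *: x) \in <[S x]>%VS.

Local Notation e i := (delta_mx 0 i : 'rV[L]_n.+2).

Let S0 : S 0 = 0.
Proof. by apply: (addrI (S 0)); rewrite -S_additive !addr0. Qed.

Let SB : {morph S : x y / x - y}.
Proof. by move=> x y; apply: (addIr (S y)); rewrite -S_additive !subrK. Qed.

Let scalar a := S (a *: e 0) 0 0.

Let S_axis a i : S (a *: e i) = scalar a *: e i.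
Proof.
have axis j : exists k, S (a *: e j) = k *: e j.
  by have /vlineP[k] := S_line a (e j); rewrite S_delta; exists k.
have [k0 axis0] := axis 0.
have scalarE : scalar a = k0 by rewrite /scalar axis0 !mxE !eqxx mulr1.
have [->|i0] := eqVneq i 0; first by rewrite axis0 scalarE.
have [ki axis_i] := axis i; have /vlineP[k] := S_line a (e 0 + e i).
rewrite scalerDr !S_additive !S_delta axis0 axis_i scalarE => /rowP diagonal.
have := diagonal 0; have := diagonal i.
rewrite !mxE !eqxx /= (negPf i0) eq_sym (negPf i0).
by rewrite ?(mulr0, mulr1, addr0, add0r) => -> <-.
Qed.

Lemma exists_semilinear_rmorphism :
  exists tau : {rmorphism L -> L}, forall x, S x = map_mx tau x.
Proof.
have scalarB : zmod_morphism scalar by move=> a b; rewrite /scalar scalerBl SB !mxE.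
have scalarM : monoid_morphism scalar.
  split=> [|a b]; first by rewrite /scalar scale1r S_delta mxE !eqxx.
  have /vlineP[k] := S_line a (e 0 + b *: e 1).
  rewrite scalerDr scalerA !S_additive !S_axis S_delta => /rowP image.
  have := image 0; have := image 1; rewrite !mxE !eqxx /=.
  by rewrite ?(mulr0, mulr1, addr0, add0r) => -> ->.
pose tau : {rmorphism L -> L} := HB.pack_for {rmorphism L -> L} scalar
  (GRing.isZmodMorphism.Build L L scalar scalarB)
  (GRing.isMonoidMorphism.Build L L scalar scalarM).
exists tau => x; rewrite {1}[x]row_sum_delta (big_morph S S_additive S0).
rewrite [RHS]row_sum_delta; apply: eq_bigr => i _.
by rewrite S_axis mxE.
Qed.

End Semilinear.

Definition moore_mx (L : Type) (tau : L -> L) n (x : 'rV[L]_n) : 'M[L]_n :=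
  \matrix_(i, j) iter i tau (x 0 j).

Definition coordinatewise (L : comUnitRingType) (tau : L -> L) n (E : 'M[L]_n)
    (v : 'rV[L]_n) : 'rV[L]_n := map_mx tau (v *m invmx E) *m E.

Lemma cyclic_coordinatewiseE (L : fieldType) (tau : L -> L) n (E : 'M[L]_n) v :
  E \in unitmx ->
  cyclic_vector (coordinatewise tau E) n v = (moore_mx tau (v *m invmx E) \in unitmx).
Proof.
move=> E_unit; have coordinatesE i :
    iter i (coordinatewise tau E) v *m invmx E =
    \row_j iter i tau ((v *m invmx E) 0 j).
  elim: i => [|i IH]; first by apply/rowP => j; rewrite [RHS]mxE.
  by rewrite iterS mulmxK // IH; apply/rowP => j; rewrite !mxE.
rewrite -row_free_unit.
transitivity (row_free (moore_mx tau (v *m invmx E) *m E)).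
  rewrite -free_rows /cyclic_vector trajectE; congr free; congr tval.
  apply: eq_from_tnth => i; rewrite !tnth_mktuple row_mul.
  rewrite -[LHS](mulmxKV E_unit) coordinatesE; congr (_ *m _).
  by apply/rowP => j; rewrite !mxE.
by rewrite /row_free mxrankMfree // row_free_unit.
Qed.

Section MooreCount.
Variables (K L : finFieldType) (f : {rmorphism K -> L}) (tau : {rmorphism L -> L}).
Variables (n : nat) (b : L).
Hypothesis cardL : #|L| = (#|K| ^ n.+1)%N.
Hypothesis tau_fixes : forall a, tau (f a) = f a.
Hypothesis conjugates_uniq : uniq (traject tau b n.+1).

Lemma moore_mxM (x : 'rV[L]_n.+1) (A : 'M[K]_n.+1) :
  moore_mx tau (x *m map_mx f A) = moore_mx tau x *m map_mx f A.
Proof.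
apply/matrixP => i j; rewrite !mxE; under [RHS]eq_bigr do rewrite !mxE.
elim: {i}(nat_of_ord i) => [|m IH] /=; first by apply: eq_bigr => k _; rewrite mxE.
by rewrite IH rmorph_sum; apply: eq_bigr => k _; rewrite rmorphM tau_fixes.
Qed.

Lemma moore_mx_powers_unit : moore_mx tau (\row_(j < n.+1) b ^+ j) \in unitmx.
Proof.
rewrite -unitmx_tr unitmxE unitfE.
rewrite (_ : _^T = Vandermonde n.+1 (\row_i iter i tau b)).
  rewrite det_Vandermonde; apply/prodf_neq0 => i _; apply/prodf_neq0 => j ij.
  rewrite subr_eq0 !mxE -!(nth_traject tau (ltn_ord _) b).
  by rewrite nth_uniq ?size_traject // gtn_eqF.
apply/matrixP => i j; rewrite !mxE; elim: {j}(nat_of_ord j) => //= m ->.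
by rewrite rmorphXn.
Qed.

Lemma card_unit_moore_mx :
  #|[set x : 'rV[L]_n.+1 | moore_mx tau x \in unitmx]| = #|'GL_n.+1[K]%g|.
Proof.
pose combine (A : 'M[K]_n.+1) : 'rV[L]_n.+1 := (\row_(j < n.+1) b ^+ j) *m map_mx f A.
have combine_inj : injective combine.
  move=> A B AB; apply/(map_mx_inj (f := f))/(can_inj (mulKmx moore_mx_powers_unit)).
  by rewrite -!moore_mxM -/(combine _) AB.
have combine_bij : bijective combine.
  by apply: inj_card_bij => //; rewrite !card_mx cardL -expnM mul1n.
rewrite -(on_card_preimset (onW_bij _ combine_bij)) -[RHS](card_imset _ val_inj).
apply: eq_card => A.
rewrite !inE moore_mxM unitmx_mul moore_mx_powers_unit map_unitmx /=.
apply/idP/imsetP => [A_unit|[B _ ->]]; last exact: (valP B).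
by exists (Sub A A_unit); rewrite ?inE ?SubK.
Qed.

End MooreCount.

(** * The Bose representation *)

(* The default value is never taken, as [iota] will be bijective. *)
Definition lift_sigma (K L : finFieldType) (iota : 'rV[L]_3 -> 'rV[K]_9)
    (sigma : 'End('rV[K]_9)) (v : 'rV[L]_3) : 'rV[L]_3 :=
  odflt 0 [pick w | iota w == sigma (iota v)].

Section Bose.
Variables (K L : finFieldType) (f : {rmorphism K -> L}) (E : 'M[L]_3).
Variables (phi : point 'rV[L]_3 -> point 'rV[L]_3).
Variables (iota : 'rV[L]_3 -> 'rV[K]_9) (sigma : 'End('rV[K]_9)).
Hypothesis E_unit : E \in unitmx.
Hypothesis phi_order : has_order3 phi.
Hypothesis iota_id : identification f iota.
Hypothesis sigma_ind : induced_by iota E phi sigma.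
Implicit Types (P : point 'rV[L]_3) (B : point 'rV[K]_9) (pi : plane 'rV[K]_9).

Local Notation q := #|K|.
Local Notation g := (gcdn 3 q.-1).
Local Notation s := (lift_sigma iota sigma).

Let iota_inj : injective iota. Proof. exact/bij_inj/(proj1 iota_id). Qed.
Let iota_lin := proj2 iota_id.
Let iota_eq0 := restr_scalars_eq0 iota_inj iota_lin.

Let sigma_inj : lker sigma == 0%VS. Proof. by have [-> _ _] := sigma_ind. Qed.

Lemma iota_surj u : exists v, u = iota v.
Proof. by have [[iota' _ iota'K] _] := iota_id; exists (iota' u). Qed.

Lemma sigma_iota v : sigma (iota v) = iota (s v).
Proof.
have [w sigma_w] := iota_surj (sigma (iota v)).
by rewrite /lift_sigma; case: pickP => [x /eqP //|/(_ w)]; rewrite sigma_w eqxx.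
Qed.

Lemma point_iota B : exists2 v, v != 0 & flat_space B = <[iota v]>%VS.
Proof.
have [u u0 ->] := point_vector B; have [v uv] := iota_surj u.
by exists v; rewrite -?iota_eq0 -uv.
Qed.

Lemma mem_bose P v : (iota v \in bose iota P) = (v \in flat_space P).
Proof.
apply/idP/idP => [|vP]; last exact/memv_span/image_f.
move/(coord_span (X := map_tuple iota (in_tuple (enum (flat_space P))))).
rewrite -(restr_scalars_lincomb iota_lin) => /iota_inj ->.
apply: memv_suml => i _; rewrite memvZ //.
by rewrite -mem_enum (mem_nth _ (ltn_ord i)).
Qed.

Lemma lift_sigmaD : {morph s : u v / u + v}.
Proof.
move=> u v; apply: iota_inj.
by rewrite -sigma_iota !(restr_scalarsD iota_lin) linearD /= !sigma_iota.
Qed.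

Lemma lift_sigmaZ a v : s (f a *: v) = f a *: s v.
Proof.
apply: iota_inj.
by rewrite -sigma_iota !(restr_scalarsZ iota_lin) linearZ /= sigma_iota.
Qed.

Lemma lift_sigma_eq0 v : (s v == 0) = (v == 0).
Proof.
rewrite -iota_eq0 -sigma_iota -[RHS]iota_eq0 -[X in _ == X](linear0 sigma).
exact/inj_eq/lker0P.
Qed.

Lemma phi_vline P v : v != 0 -> flat_space P = <[v]>%VS ->
  flat_space (phi P) = <[s v]>%VS.
Proof.
move=> v0 Pv; apply/eqP; rewrite -mem_pointE ?lift_sigma_eq0 //.
have [_ sigma_bose _] := sigma_ind.
by rewrite -mem_bose -sigma_bose -sigma_iota memv_img // mem_bose Pv memv_line.
Qed.

Lemma lift_sigma_line a v : s (a *: v) \in <[s v]>%VS.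
Proof.
have [->|av0] := eqVneq (a *: v) 0.
  by have /eqP -> : s 0 == 0; rewrite ?lift_sigma_eq0 ?mem0v.
have v0 : v != 0 by apply: contraNneq av0 => ->; rewrite scaler0.
have [P Pv] := vector_point v0; rewrite -(phi_vline v0 Pv).
rewrite (phi_vline av0) ?memv_line // Pv; apply/esym/vline_eq => //.
by rewrite memvZ ?memv_line.
Qed.

Lemma lift_sigma3_line v : iter 3 s v \in <[v]>%VS.
Proof.
have [->|v0] := eqVneq v 0; first by rewrite memv0 !lift_sigma_eq0.
have sv0 : s v != 0 by rewrite lift_sigma_eq0.
have ssv0 : s (s v) != 0 by rewrite lift_sigma_eq0.
have [phi3 _] := phi_order; have [P Pv] := vector_point v0.
rewrite -Pv -[P]phi3 (phi_vline ssv0 (phi_vline sv0 (phi_vline v0 Pv))).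
exact: memv_line.
Qed.

Lemma lift_sigma_coordinatewise :
  exists tau : {rmorphism L -> L}, s =1 coordinatewise tau E.
Proof.
pose S x := s (x *m E) *m invmx E.
have [|||tau S_tau] := @exists_semilinear_rmorphism L 1 S.
- by move=> x y; rewrite /S mulmxDl lift_sigmaD mulmxDl.
- move=> i; have [_ _ sigma_row] := sigma_ind.
  rewrite /S -rowE -[RHS](mulmxK E_unit) -rowE; congr (_ *m _).
  by apply: iota_inj; rewrite -sigma_iota sigma_row.
- move=> a x; rewrite /S -scalemxAl.
  have /vlineP[k ->] := lift_sigma_line a (x *m E).
  by rewrite -scalemxAl memvZ ?memv_line.
by exists tau => v; rewrite /coordinatewise -S_tau /S !mulmxKV.
Qed.

Section FieldAutomorphism.
Variable tau : {rmorphism L -> L}.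
Hypothesis s_tau : s =1 coordinatewise tau E.

Let s_coord x : s (x *m E) = map_mx tau x *m E.
Proof. by rewrite s_tau /coordinatewise mulmxK. Qed.

Lemma lift_sigma_rmorphism_fixes a : tau (f a) = f a.
Proof.
have := lift_sigmaZ a (delta_mx 0 0 *m E); rewrite scalemxAl !s_coord scalemxAl.
move/(can_inj (mulmxK E_unit))/rowP/(_ 0).
by rewrite !mxE !eqxx /= mulr1 rmorph1 mulr1.
Qed.

(* [s^3] multiplies [(1, b, 0)] by a scalar, which is 1 by the first coordinate. *)
Lemma lift_sigma_rmorphism_order b : tau (tau (tau b)) = b.
Proof.
pose x : 'rV[L]_3 := delta_mx 0 0 + b *: delta_mx 0 1.
have /vlineP[k] := lift_sigma3_line (x *m E); rewrite /= !s_coord scalemxAl.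
move=> /(can_inj (mulmxK E_unit))/rowP x3.
have := x3 0; have := x3 1; rewrite !mxE !eqxx /=.
rewrite !(mulr0, mulr1, addr0, add0r, rmorph1) => ->.
by move=> <-; rewrite mul1r.
Qed.

Lemma lift_sigma_rmorphism_neq_id : exists b, tau b != b.
Proof.
have [_ [P phiP]] := phi_order; apply/existsP; apply: contra_notT phiP.
rewrite negb_exists => /forallP tau_id; have [v v0 Pv] := point_vector P.
apply: flat_space_inj; rewrite (phi_vline v0 Pv) Pv s_tau; congr <[_]>%VS.
rewrite -[RHS](mulmxKV E_unit); congr (_ *m _); apply/rowP => i.
by rewrite mxE; apply/eqP/negPn/tau_id.
Qed.

End FieldAutomorphism.

Lemma lift_sigma_order v : iter 3 s v = v.
Proof.
have [tau s_tau] := lift_sigma_coordinatewise.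
rewrite /= !s_tau /coordinatewise !mulmxK // -[RHS](mulmxKV E_unit); congr (_ *m _).
by apply/rowP => i; rewrite !mxE (lift_sigma_rmorphism_order s_tau).
Qed.

Lemma sigma_order u : iter 3 sigma u = u.
Proof.
have [v ->] := iota_surj u.
by rewrite /= !sigma_iota; congr iota; apply: lift_sigma_order.
Qed.

Lemma card_cyclic_lift_sigma : #|L| = (q ^ 3)%N ->
  #|[set v | cyclic_vector s 3 v]| = #|'GL_3[K]%g|.
Proof.
move=> cardL; have [tau s_tau] := lift_sigma_coordinatewise.
have [b tau_b] := lift_sigma_rmorphism_neq_id s_tau.
have conjugates_uniq : uniq (traject tau b 3).
  have tau_inj := fmorph_inj tau.
  have tau2_b : tau (tau b) != b.
    by rewrite -(inj_eq tau_inj) (lift_sigma_rmorphism_order s_tau) eq_sym.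
  rewrite /= !inE negb_or !andbT (inj_eq tau_inj) ![b == _]eq_sym.
  by rewrite tau_b tau2_b.
have tau_fixes := lift_sigma_rmorphism_fixes s_tau.
rewrite -(card_unit_moore_mx cardL tau_fixes conjugates_uniq).
rewrite -[RHS](card_imset _ (can_inj (mulmxK E_unit))); apply: eq_card => v.
rewrite inE /cyclic_vector /= !s_tau -/(cyclic_vector _ 3 v).
rewrite cyclic_coordinatewiseE //.
apply/idP/imsetP => [v_unit|[x + ->]]; last by rewrite inE mulmxK.
by exists (v *m invmx E); rewrite ?inE // mulmxKV.
Qed.

Lemma exists_bose_pointE (Q : pred (point 'rV[L]_3)) B P v :
  v != 0 -> flat_space B = <[iota v]>%VS -> flat_space P = <[v]>%VS ->
  [exists P', Q P' && (B <= bose iota P')%VS] = Q P.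
Proof.
move=> v0 Bv Pv; apply/existsP/idP => [[P' /andP[QP']]|QP]; last first.
  by exists P; rewrite QP Bv -memvE mem_bose Pv memv_line.
by rewrite Bv -memvE mem_bose mem_pointE // -Pv => /eqP/flat_space_inj <-.
Qed.

Lemma phi_collinearE P v : v != 0 -> flat_space P = <[v]>%VS ->
  collinear P (phi P) (phi (phi P)) = ~~ cyclic_vector s 3 v.
Proof.
move=> v0 Pv; have sv0 : s v != 0 by rewrite lift_sigma_eq0.
rewrite (phi_vline sv0 (phi_vline v0 Pv)) (phi_vline v0 Pv) Pv collinearE //.
by rewrite dimvf.
Qed.

Lemma III_pointE B v : v != 0 -> flat_space B = <[iota v]>%VS ->
  III_point iota phi B = cyclic_vector s 3 v.
Proof.
move=> v0 Bv; have [P Pv] := vector_point v0.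
by rewrite /III_point (exists_bose_pointE (type_III phi) v0 Bv Pv) /type_III
  (phi_collinearE v0 Pv) negbK.
Qed.

Lemma phi_distinctE P v : v != 0 -> flat_space P = <[v]>%VS ->
  uniq [:: P; phi P; phi (phi P)] = (s v \notin <[v]>%VS).
Proof.
move=> v0 Pv; have [phi3 _] := phi_order.
have phi_inj : injective phi by apply: (can_inj (g := phi \o phi)) => x; apply: phi3.
have phiP : (P == phi P) = (s v \in <[v]>%VS).
  rewrite -Pv mem_pointE ?lift_sigma_eq0 // -(phi_vline v0 Pv).
  by rewrite (inj_eq (@flat_space_inj _ _ _)).
have phi2P : (P == phi (phi P)) = (P == phi P).
  by rewrite -(inj_eq phi_inj) phi3 eq_sym.
by rewrite /= !inE !andbT (inj_eq phi_inj) phi2P orbb andbb phiP.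
Qed.

Lemma II_pointE B v : v != 0 -> flat_space B = <[iota v]>%VS ->
  II_point iota phi B = (s v \notin <[v]>%VS) && ~~ cyclic_vector s 3 v.
Proof.
move=> v0 Bv; have [P Pv] := vector_point v0.
by rewrite /II_point (exists_bose_pointE (type_II phi) v0 Bv Pv) /type_II
  (phi_distinctE v0 Pv) (phi_collinearE v0 Pv).
Qed.

Lemma fixed_pointE B u : u != 0 -> flat_space B = <[u]>%VS ->
  fixed sigma B = (sigma u \in <[u]>%VS).
Proof. by move=> u0 Bu; rewrite /fixed Bu limg_stable_eq // limg_line -memvE. Qed.

Lemma traject_sigma_iota w : traject sigma (iota w) 3 = map iota (traject s w 3).
Proof. by rewrite /= !sigma_iota. Qed.

Lemma cyclic_iota v : cyclic_vector s 3 v -> cyclic_vector sigma 3 (iota v).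
Proof.
rewrite /cyclic_vector traject_sigma_iota.
exact: (free_restr_scalars iota_inj iota_lin (X := [tuple v; s v; s (s v)])).
Qed.

Lemma III_point_stable_dim B (U : {vspace 'rV[K]_9}) :
  (sigma @: U <= U)%VS -> (B <= U)%VS -> III_point iota phi B -> (3 <= \dim U)%N.
Proof.
move=> sU BU; have [w w0 Bw] := point_iota B; rewrite (III_pointE w0 Bw).
move/cyclic_iota; apply: cyclic_vector_dim sU _.
by rewrite memvE -Bw.
Qed.

Section OrbitPlane.
Variable v : 'rV[L]_3.
Hypothesis v_cyclic : cyclic_vector s 3 v.
Local Notation W := (orbit_space sigma 3 (iota v)).

Lemma free_iota m (Y : m.-tuple 'rV[L]_3) :
  {subset map iota Y <= W} -> free (map iota Y) = free Y.
Proof.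
rewrite /orbit_space traject_sigma_iota.
exact: (free_restr_scalarsE iota_inj iota_lin (X := [tuple v; s v; s (s v)])).
Qed.

Lemma cyclic_in_plane w : iota w \in W ->
  cyclic_vector s 3 w = cyclic_vector sigma 3 (iota w).
Proof.
move=> wW; rewrite /cyclic_vector traject_sigma_iota.
apply/esym/(free_iota (Y := [tuple w; s w; s (s w)])) => x.
rewrite /= -!sigma_iota !inE.
by case/or3P => /eqP ->; rewrite ?(orbit_space_image sigma_order).
Qed.

Lemma lift_sigma_vline_in_plane w : w != 0 -> iota w \in W ->
  (s w \in <[w]>%VS) = (sigma (iota w) \in <[iota w]>%VS).
Proof.
move=> w0 wW; have notin_vlineE (F : fieldType) (V : vectType F) (x y : V) :
    y != 0 -> (x \notin <[y]>%VS) = free [:: x; y].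
  by move=> y0; rewrite free_cons span_seq1 seq1_free y0 andbT.
apply: negb_inj; rewrite !notin_vlineE ?iota_eq0 // sigma_iota.
apply/esym/(free_iota (Y := [tuple s w; w])) => x; rewrite /= -sigma_iota !inE.
by case/orP => /eqP ->; rewrite ?(orbit_space_image sigma_order).
Qed.

Lemma plane_point_iota B : (B <= W)%VS ->
  exists w, [/\ w != 0, flat_space B = <[iota w]>%VS & iota w \in W].
Proof. by have [w w0 Bw] := point_iota B; rewrite Bw -memvE; exists w. Qed.

Lemma plane_III_pointE B u : u != 0 -> flat_space B = <[u]>%VS ->
  (B <= W)%VS && III_point iota phi B = (u \in W) && cyclic_vector sigma 3 u.
Proof.
move=> u0 Bu; rewrite Bu -memvE; apply: andb_id2l => uW.
have [w uw] := iota_surj u; rewrite uw -?cyclic_in_plane -?uw //.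
by apply: III_pointE; rewrite -?iota_eq0 -uw.
Qed.

Lemma plane_II_collinear_pointE B : (B <= W)%VS ->
  II_collinear_point iota phi sigma B = ~~ fixed sigma B && ~~ III_point iota phi B.
Proof.
case/plane_point_iota => w [w0 Bw wW]; have iw0 : iota w != 0 by rewrite iota_eq0.
rewrite /II_collinear_point (II_pointE w0 Bw) (fixed_pointE iw0 Bw).
rewrite (III_pointE w0 Bw).
rewrite lift_sigma_vline_in_plane // Bw !limg_line collinearE ?dimvf //.
by rewrite -/(cyclic_vector sigma 3 (iota w)) -cyclic_in_plane // -andbA andbb.
Qed.

End OrbitPlane.

Lemma fixed_plane_orbit_space pi w : fixed sigma pi -> iota w \in flat_space pi ->
  cyclic_vector s 3 w -> flat_space pi = orbit_space sigma 3 (iota w).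
Proof.
rewrite /fixed limg_stable_eq // => spi wpi w_cyclic; apply/esym/eqP.
by rewrite eqEdim orbit_space_min // dim_flat dim_orbit_space ?cyclic_iota.
Qed.

Lemma fixed_III_planeP pi :
  reflect (exists2 v, cyclic_vector s 3 v &
                      flat_space pi = orbit_space sigma 3 (iota v))
          (fixed_III_plane iota phi sigma pi).
Proof.
apply: (iffP andP) => [[fix_pi /existsP[B /andP[+ Bpi]]]|[v v_cyclic piE]].
  have [w w0 Bw] := point_iota B; rewrite (III_pointE w0 Bw) => w_cyclic.
  by exists w => //; apply: fixed_plane_orbit_space; rewrite // memvE -Bw.
have v0 := cyclic_vector_neq0 v_cyclic.
have [B Bv] : exists B, flat_space B = <[iota v]>%VS.
  by apply: vector_point; rewrite iota_eq0.
split; first by rewrite /fixed limg_stable_eq // piE (orbit_space_stable sigma_order).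
apply/existsP; exists B; rewrite (III_pointE v0 Bv) v_cyclic Bv piE -memvE.
exact: orbit_space_mem.
Qed.

Section FixedIIIPlane.
Variable pi : plane 'rV[K]_9.
Hypothesis pi_III : fixed_III_plane iota phi sigma pi.

Lemma card_III_plane_fixed_points :
  #|[set B : point 'rV[K]_9 | (B <= pi)%VS & fixed sigma B]| = g.
Proof.
have [v /cyclic_iota v_cyclic ->] := fixed_III_planeP _ pi_III.
exact: card_fixed_points sigma_order v_cyclic.
Qed.

Lemma card_III_plane_III_points :
  (#|[set B : point 'rV[K]_9 | (B <= pi)%VS & III_point iota phi B]| * q.-1)%N =
  #|[set x : 'rV[K]_3 | circulant x \in unitmx]|.
Proof.
have [v v_cyclic ->] := fixed_III_planeP _ pi_III.
rewrite -(card_cyclic_vectors sigma_order (cyclic_iota v_cyclic)).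
rewrite (card_points (plane_III_pointE v_cyclic)); apply: eq_card => u; rewrite !inE.
by rewrite andb_idl // => /andP[_ /cyclic_vector_neq0].
Qed.

Lemma card_III_plane_partition :
  (#|[set B : point 'rV[K]_9 | (B <= pi)%VS & fixed sigma B]| +
   #|[set B : point 'rV[K]_9 | (B <= pi)%VS & II_collinear_point iota phi sigma B]| +
   #|[set B : point 'rV[K]_9 | (B <= pi)%VS & III_point iota phi B]|)%N =
  (q ^ 2 + q + 1)%N.
Proof.
transitivity #|[set B : point 'rV[K]_9 | (B <= pi)%VS]|; last first.
  by rewrite card_points_sub dim_flat !big_ord_recr big_ord0 /= expn1; lia.
have [v v_cyclic ->] := fixed_III_planeP _ pi_III.
rewrite -!sum1dep_card !big_mkcondr /= -!big_split.
apply: eq_bigr => B BW; rewrite (plane_II_collinear_pointE v_cyclic BW).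
case: (boolP (fixed sigma B)) => [/eqP fixB|_]; last by case: III_point.
have sB : (sigma @: B <= B)%VS by rewrite fixB.
case: (boolP (III_point iota phi B)) => // /(III_point_stable_dim sB (subvv _)).
by rewrite dim_flat.
Qed.

(* A fixed line has [q + 1] points, more than the [g] fixed points of the plane. *)
Lemma III_plane_fixed_II_lineE (l : line 'rV[K]_9) : (l <= pi)%VS ->
  fixed_II_line iota phi sigma l = fixed sigma l.
Proof.
move=> l_pi; apply: andb_idr => fix_l.
have /subsetPn[B] : ~~ ([set B : point 'rV[K]_9 | (B <= l)%VS] \subset
    [set B : point 'rV[K]_9 | (B <= pi)%VS & fixed sigma B]).
  apply/negP => /subset_leq_card; rewrite card_III_plane_fixed_points.
  rewrite card_points_sub dim_flat !big_ord_recr big_ord0 /= expn1 add1n => q_lt_g.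
  have := leq_trans q_lt_g (dvdn_leq (finField_pred_gt0 K) (dvdn_gcdr 3 q.-1)).
  by rewrite ltnNge leq_pred.
rewrite !inE => Bl; have B_pi := subv_trans Bl l_pi; rewrite B_pi /= => nfixB.
apply/existsP; exists B; have [v v_cyclic piE] := fixed_III_planeP _ pi_III.
rewrite Bl andbT (plane_II_collinear_pointE v_cyclic) -?piE // nfixB /=.
have sl : (sigma @: l <= l)%VS by rewrite -limg_stable_eq.
by apply/negP => /(III_point_stable_dim sl Bl); rewrite dim_flat.
Qed.

Lemma card_III_plane_II_lines :
  #|[set l : line 'rV[K]_9 | (l <= pi)%VS & fixed_II_line iota phi sigma l]| = g.
Proof.
transitivity #|[set l : line 'rV[K]_9 | (l <= pi)%VS & fixed sigma l]|.
  apply: eq_card => l; rewrite !inE; apply: andb_id2l.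
  exact: III_plane_fixed_II_lineE.
have [v /cyclic_iota v_cyclic ->] := fixed_III_planeP _ pi_III.
exact: (card_fixed_hyperplanes sigma_order v_cyclic).
Qed.

End FixedIIIPlane.

Lemma card_III_points : #|L| = (q ^ 3)%N ->
  #|[set B : point 'rV[K]_9 | III_point iota phi B]| =
  (q ^ 3 * ((q ^ 2 - 1) * (q ^ 3 - 1)))%N.
Proof.
move=> cardL; apply/eqP; rewrite -(eqn_pmul2r (finField_pred_gt0 K)); apply/eqP.
have [[iota' iotaK iota'K] _] := iota_id.
rewrite (card_points (R := fun u => cyclic_vector s 3 (iota' u))); last first.
  by move=> B u u0 Bu; apply: III_pointE; rewrite -?iota_eq0 iota'K.
rewrite (_ : [set _ | _] = iota' @^-1: [set v | cyclic_vector s 3 v]); last first.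
  apply/setP => u; rewrite !inE andb_idl // => /cyclic_vector_neq0.
  by rewrite -iota_eq0 iota'K.
have iota'_bij : bijective iota' by exists iota.
rewrite (on_card_preimset (onW_bij _ iota'_bij)) card_cyclic_lift_sigma // card_GL //.
rewrite 3?big_ltn // big_geq // muln1 expn1 -subn1.
by rewrite mulnCA [RHS]mulnC.
Qed.

Lemma card_fixed_III_planes N :
  (forall pi, fixed_III_plane iota phi sigma pi ->
    #|[set B : point 'rV[K]_9 | (B <= pi)%VS & III_point iota phi B]| = N) ->
  (#|[set pi : plane 'rV[K]_9 | fixed_III_plane iota phi sigma pi]| * N)%N =
  #|[set B : point 'rV[K]_9 | III_point iota phi B]|.
Proof.
move=> cardN; rewrite -[RHS]muln1.
apply: (card_incidence (inc := fun pi B => (B <= pi)%VS)) => [pi|B BIII].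
  by move/cardN => <-; apply: eq_card => B; rewrite !inE andbC.
have [w w0 Bw] := point_iota B; have := BIII; rewrite (III_pointE w0 Bw) => w_cyclic.
have [pi piE] := exists_flat (dim_orbit_space (cyclic_iota w_cyclic)).
rewrite (_ : [set _ | _] = [set pi]) ?cards1 //; apply/setP => rho; rewrite !inE.
apply/andP/eqP => [[/andP[fix_rho _]]|->].
  rewrite Bw -memvE => w_rho; apply: flat_space_inj.
  by rewrite piE (fixed_plane_orbit_space fix_rho w_rho).
split; first by apply/fixed_III_planeP; exists w.
by rewrite Bw piE -memvE orbit_space_mem.
Qed.

Lemma card_fixed_III_planesQ N : #|L| = (q ^ 3)%N -> (0 < N)%N ->
  (forall pi, fixed_III_plane iota phi sigma pi ->
    #|[set B : point 'rV[K]_9 | (B <= pi)%VS & III_point iota phi B]| = N) ->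
  #|[set pi : plane 'rV[K]_9 | fixed_III_plane iota phi sigma pi]|%:Q =
  (q%:Q ^+ 3 * (q%:Q ^+ 2 - 1) * (q%:Q - 1) * (q%:Q ^+ 2 + q%:Q + 1)) / N%:Q.
Proof.
move=> cardL N_gt0 cardN.
have N0 : N%:Q != 0 by rewrite intr_eq0; case: N N_gt0 {cardN}.
apply: (canRL (mulfK N0)); rewrite -intrM -PoszM (card_fixed_III_planes cardN).
rewrite card_III_points //; case: #|K| (finNzRing_gt1 K) => // k _.
have -> : (k.+1 ^ 2 - 1 = k * k.+2)%N by lia.
have -> : (k.+1 ^ 3 - 1 = k * (k.+1 ^ 2 + k.+1 + 1))%N by lia.
by rewrite -!pmulrn !(natrM, natrX, natrD) -(natr1 k.+1) -(natr1 k); ring.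
Qed.

End Bose.

Theorem theorem20 (q g : nat) (n : int) (K L : finFieldType)
    (f : {rmorphism K -> L}) (E : 'M[L]_3)
    (phi : point 'rV[L]_3 -> point 'rV[L]_3)
    (iota : 'rV[L]_3 -> 'rV[K]_9) (sigma : 'End('rV[K]_9))
    (q_gt2 : (2 < q)%N)
    (cardK : #|K| = q) (cardL : #|L| = (q ^ 3)%N)
    (n_val : n \in [:: -1; 0; 1]) (n_mod : (q%:Z = n %[mod 3])%Z)
    (g_def : g = gcdn 3 (q - 1))
    (E_unit : E \in unitmx)
    (phi_coll : collineation phi) (phi_order : has_order3 phi)
    (phi_fix : forall P, P \in subplane f E -> phi P = P)
    (iota_id : identification f iota)
    (sigma_ind : induced_by iota E phi sigma) :
  #|[set pi : plane 'rV[K]_9 | fixed_III_plane iota phi sigma pi]|%:Q =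
    (q%:Q ^+ 3 * (q%:Q ^+ 2 - 1) * (q%:Q - 1) * (q%:Q ^+ 2 + q%:Q + 1)) /
    (q%:Q ^+ 2 + q%:Q + 1 - g%:Q * (q%:Q - n%:Q + 1))
  /\
  forall pi : plane 'rV[K]_9, fixed_III_plane iota phi sigma pi ->
    [/\ #|[set B : point 'rV[K]_9 | (B <= pi)%VS & fixed sigma B]| = g,
        #|[set B : point 'rV[K]_9 | (B <= pi)%VS &
            II_collinear_point iota phi sigma B]|%:Z = g%:Z * (q%:Z - n),
        #|[set B : point 'rV[K]_9 | (B <= pi)%VS & III_point iota phi B]|%:Z =
          q%:Z ^+ 2 + q%:Z + 1 - g%:Z * (q%:Z - n + 1)
      & #|[set l : line 'rV[K]_9 | (l <= pi)%VS &
            fixed_II_line iota phi sigma l]| = g].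
Proof.
rewrite subn1 in g_def; subst q g.
have [N [N_gt0 N_val card_units]] := card_unit_circulant3_mod3 n_val n_mod.
have card_III pi : fixed_III_plane iota phi sigma pi ->
    #|[set B : point 'rV[K]_9 | (B <= pi)%VS & III_point iota phi B]| = N.
  move=> pi_III; apply/eqP; rewrite -(eqn_pmul2r (finField_pred_gt0 K)) -card_units.
  by rewrite (card_III_plane_III_points E_unit phi_order iota_id sigma_ind pi_III).
split=> [|pi pi_III].
  rewrite (card_fixed_III_planesQ E_unit phi_order iota_id sigma_ind cardL N_gt0) //.
  by rewrite N_val rmorphB !rmorphD rmorphXn rmorphM rmorphD rmorphB.
have card_fixed :=
  card_III_plane_fixed_points E_unit phi_order iota_id sigma_ind pi_III.
have := card_III_plane_partition E_unit phi_order iota_id sigma_ind pi_III.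
rewrite card_fixed (card_III pi pi_III) => /(congr1 Posz).
rewrite !PoszD N_val => card_sum.
split=> //; first by lia.
exact: (card_III_plane_II_lines E_unit phi_order iota_id sigma_ind pi_III).
Qed.
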